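(* Let $\alpha\in(0,1)$ and let $r_\sigma=\max_{i,j\in[m]}(\sigma^\#_i/\sigma^\#_j)$. If the separation distances $\bar\kappa_{\text{in-in}}$ and $\bar\kappa_{\text{in-out}}$ corresponding to $(\theta^\#,\sigma^\#,\pi^* )$ satisfy $$\bar\kappa_{\text{in-in}}\ \ge\ 2\big(4d\log(4nm/\alpha)\big)^{1/4}+2\big(2\log(4nm/\alpha)\big)^{1/2},$$ $$\bar\kappa_{\text{in-out}}\ \ge\ \sqrt{2(r_\sigma-1)d}+2\big(4r_\sigma^2\,d\log(4nm/\alpha)\big)^{1/4}+2\big(2r_\sigma\log(4nm/\alpha)\big)^{1/2},$$ then the LSL estimator $\hat\pi^{\mathrm{LSL}}_{n,m}$ detects the matching map $\pi^*$ with probability at least $1-\alpha$, that is, $$\mathbf P_{\theta^\#,\sigma^\#,\pi^*}\big(\hat\pi^{\mathrm{LSL}}_{n,m}=\pi^*\big)\ge1-\alpha.$$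
   Context: Notation: $[n]=\{1,\dots,n\}$; $\|\cdot\|$ is the Euclidean norm on $\mathbb R^d$. Model. Let $m>n\ge 2$ and $d\ge1$ be integers. The parameters are $\theta^\#=(\theta^\#_1,\dots,\theta^\#_m)$ with $\theta^\#_j\in\mathbb R^d$, $\sigma^\#=(\sigma^\#_1,\dots,\sigma^\#_m)$ with $\sigma_j^\#>0$, and an injective map $\pi^*:[n]\to[m]$. For $i\in[n]$ put $\theta_i=\theta^\#_{\pi^*(i)}$ and $\sigma_i=\sigma^\#_{\pi^*(i)}$. One observes $$X_i=\theta_i+\sigma_i\xi_i\ (i\in[n]),\qquad X^\#_j=\theta^\#_j+\sigma^\#_j\xi^\#_j\ (j\in[m]),$$ where $\xi_1,\dots,\xi_n,\xi^\#_1,\dots,\xi^\#_m$ are independent standard Gaussian vectors in $\mathbb R^d$ (zero mean, identity covariance). The law of $(X_1,\dots,X_n,X_1^\#,\dots,X_m^\#)$ is denoted $\mathbf P_{\theta^\#,\sigma^\#,\pi^*}$. The outlier index set is $O_{\pi^*}=[m]\setminus\mathrm{Im}(\pi^* )$. Separation distances: $$\bar\kappa_{\text{in-in}}=\min_{\substack{i,j\notin O_{\pi^*}\\ i\ne j}}\frac{\|\theta^\#_i-\theta^\#_j\|}{((\sigma^\#_i)^2+(\sigma^\#_j)^2)^{1/2}},\qquad \bar\kappa_{\text{in-out}}=\min_{\substack{i\notin O_{\pi^*}\\ j\in O_{\pi^*}}}\frac{\|\theta^\#_i-\theta^\#_j\|}{((\sigma^\#_i)^2+(\sigma^\#_j)^2)^{1/2}}.$$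 LSL (least sum of logarithms) estimator: $$\hat\pi^{\mathrm{LSL}}_{n,m}\in\arg\min_{\pi:[n]\to[m]}\sum_{i=1}^n\log\|X_i-X^\#_{\pi(i)}\|^2,$$ the minimum being over all injective maps $\pi:[n]\to[m]$. *)

(* Defs.v *)
From HB Require Import structures.
From mathcomp Require Import all_boot all_order all_algebra.
From mathcomp Require Import all_classical all_reals all_analysis.

Set Implicit Arguments.
Unset Strict Implicit.
Unset Printing Implicit Defensive.

Import Order.TTheory GRing.Theory Num.Theory.

Local Open Scope classical_set_scope.
Local Open Scope ring_scope.

(* Vectors of R^d are [d.-tuple R], which carries the product (Borel)
   sigma-algebra; the library puts none on ['rV[R]_d]. *)
Definition eucl_dist (R : realType) (d : nat) (x y : d.-tuple R) : R :=
  Num.sqrt (\sum_(k < d) (tnth x k - tnth y k) ^+ 2).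

Section Gaussian.
Context (dO : measure_display) (Omega : measurableType dO) (R : realType)
  (P : probability Omega R).

Definition mutually_independent (dT : measure_display) (T : measurableType dT)
    (I : finType) (X : I -> {RV P >-> T}) : Prop :=
  forall (J : {set I}) (A : I -> set T),
    (forall i, i \in J -> measurable (A i)) ->
    P (\bigcap_(i in [set` J]) (X i @^-1` A i)) =
    (\prod_(i in J) P (X i @^-1` A i))%E.

Definition vcoord (d : nat) (X : {RV P >-> d.-tuple R}) (k : 'I_d)
    : Omega -> R :=
  (fun x : d.-tuple R => tnth x k) \o X.

Lemma measurable_vcoord (d : nat) (X : {RV P >-> d.-tuple R}) (k : 'I_d) :
  measurable_fun [set: Omega] (vcoord X k).
Proof.
by apply: measurableT_comp; [exact: measurable_tnth | exact: measurable_funPT].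
Qed.

HB.instance Definition _ (d : nat) (X : {RV P >-> d.-tuple R}) (k : 'I_d) :=
  isMeasurableFun.Build _ _ _ _ (vcoord X k) (measurable_vcoord X k).

Definition standard_gaussian (d : nat) (X : {RV P >-> d.-tuple R}) : Prop :=
  mutually_independent (fun k : 'I_d => vcoord X k : {RV P >-> R}) /\
  forall (k : 'I_d) (A : set R), measurable A ->
    distribution P (vcoord X k) A = normal_prob 0 1 A.

Definition sum_family (n m : nat) (T : Type)
    (f : 'I_n -> T) (g : 'I_m -> T) (k : 'I_n + 'I_m) : T :=
  match k with inl i => f i | inr j => g j end.

End Gaussian.

Section Matching.
Context (R : realType) (n m d : nat).

Definition sample : Type :=
  (n.-tuple (d.-tuple R) * m.-tuple (d.-tuple R))%type.

Definition observe (Omega : Type) (theta : 'I_m -> d.-tuple R)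
    (sigma : 'I_m -> R) (pi : {ffun 'I_n -> 'I_m})
    (xi : 'I_n -> Omega -> d.-tuple R) (xis : 'I_m -> Omega -> d.-tuple R)
    (w : Omega) : sample :=
  ([tuple [tuple tnth (theta (pi i)) k + sigma (pi i) * tnth (xi i w) k
          | k < d] | i < n],
   [tuple [tuple tnth (theta j) k + sigma j * tnth (xis j w) k
          | k < d] | j < m]).

Definition outliers (pi : {ffun 'I_n -> 'I_m}) : {set 'I_m} :=
  ~: (pi @: [set: 'I_n])%SET.

Definition sep (theta : 'I_m -> d.-tuple R) (sigma : 'I_m -> R)
    (i j : 'I_m) : R :=
  eucl_dist (theta i) (theta j) / Num.sqrt (sigma i ^+ 2 + sigma j ^+ 2).

(* The value +oo of an empty minimum does not occur when 2 <= n < m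
   and pi is injective. *)
Definition kappa_in_in (theta : 'I_m -> d.-tuple R) (sigma : 'I_m -> R)
    (pi : {ffun 'I_n -> 'I_m}) : \bar R :=
  (\big[Order.min/+oo]_(p : 'I_m * 'I_m |
      [&& p.1 \notin outliers pi, p.2 \notin outliers pi & p.1 != p.2])
    (sep theta sigma p.1 p.2)%:E)%E.

Definition kappa_in_out (theta : 'I_m -> d.-tuple R) (sigma : 'I_m -> R)
    (pi : {ffun 'I_n -> 'I_m}) : \bar R :=
  (\big[Order.min/+oo]_(p : 'I_m * 'I_m |
      (p.1 \notin outliers pi) && (p.2 \in outliers pi))
    (sep theta sigma p.1 p.2)%:E)%E.

(* All ratios are positive, so the initial value 0 is immaterial. *)
Definition noise_ratio (sigma : 'I_m -> R) : R :=
  \big[Order.max/0]_(p : 'I_m * 'I_m) (sigma p.1 / sigma p.2).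

(* [lne] takes the value -oo at 0, unlike [ln], for which [ln 0 = 0]. *)
Definition LSL_objective (x : sample) (pi : {ffun 'I_n -> 'I_m}) : \bar R :=
  (\sum_(i < n)
     lne ((eucl_dist (tnth x.1 i) (tnth x.2 (pi i)) ^+ 2)%R%:E))%E.

(* The minimizer need not be unique: any measurable selection of the argmin
   qualifies. *)
Definition LSL_estimator (pihat : sample -> {ffun 'I_n -> 'I_m}) : Prop :=
  [/\ forall pi : {ffun 'I_n -> 'I_m},
        measurable [set x : sample | pihat x = pi],
      forall x : sample, injective (pihat x) &
      forall (x : sample) (pi : {ffun 'I_n -> 'I_m}), injective pi ->
        (LSL_objective x (pihat x) <= LSL_objective x pi)%E].

End Matching.

(* Main.v *)
From HB Require Import structures.
Require Import Defs.
From mathcomp Require Import all_boot all_order all_algebra.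
From mathcomp Require Import all_classical all_reals all_analysis.
From mathcomp Require Import measurable_realfun ring lra.

(** Write [D i j] for the squared distance between [X_i] and [X#_j], and
[v = sigma_i^2 + sigma#_j^2].  Up to the factor [v], [D i j] is a chi-square
variable with [d] degrees of freedom, central when [j = pistar i] and with
noncentrality [sep^2] otherwise.

The probabilistic part shows that, outside an event of probability at most
[alpha], simultaneously for all [i] and [j]
- [0 < D i (pistar i) < 2 sigma_i^2 t], with [t = (sqrt d + l)^2] and
  [l^2 = 2 L];
- [D i j > v q_j t] for [j] different from [pistar i], where [q_j = 1] if [j] is
  an inlier and [q_j = r] if it is an outlier.

Both tails are Chernoff bounds on the Laplace transform
[E exp (- s D) = (1 + 2 s v)^(- d / 2) exp (- s |mu|^2 / (1 + 2 s v))],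
[gaussian_pair_laplace], which holds for positive and negative [s].  Bounding
[(1 + 2 s v)^(-1/2)] with [1 + x <= exp x] is already enough and gives two neat
tails: [D >= v (sqrt d + l)^2] in the central case, [central_upper_tail], and
[D <= v tau^2] as soon as [sep^2 + d >= (tau + l)^2], [noncentral_lower_tail],
each have probability at most [exp (- l^2 / 2) = exp (- L)].  The condition on
[sep] with [tau = sqrt q_j (sqrt d + l)] follows from the separation hypothesis,
[separation_suffices].

The deterministic part shows that on this event [pistar] is the strict and
hence only minimizer, [LSL_strict_min].  For [pi i] different from [pistar i],
the inequality [x^2 + y^2 >= 2 x y] between the noise levels gives
[ln (D i (pi i)) - ln (D i (pistar i))
  > ln sigma#_(pi i) - ln sigma#_(pistar i) + ln q_(pi i)].
Summed over [i], the [ln sigma#] telescope: the indices common to the images of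
[pi] and [pistar] cancel, and each outlier used by [pi] replaces one inlier left
out, at a cost of at most [ln r], which is what [ln q_(pi i)] pays for
([sum_image_le]). *)

Set Implicit Arguments.
Unset Strict Implicit.
Unset Printing Implicit Defensive.

Import Order.TTheory GRing.Theory Num.Theory.
Import HBNNSimple.

Local Open Scope classical_set_scope.
Local Open Scope ring_scope.

(** * Integrals of functions of independent variables *)

(** Two measures on [Y], the image by [phi] of [W mu] and [c nu], agree on
measurable sets, hence integrate nonnegative functions alike.  With [phi] the
identity this is integration against a density; with [phi] a random variable and
[W] a function of other variables it is the extension of independence from
events to functions. *)
Lemma ge0_integral_weighted (dX dY : measure_display) (X : measurableType dX)
    (Y : measurableType dY) (R : realType)
    (mu : {measure set X -> \bar R}) (nu : {measure set Y -> \bar R})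
    (phi : X -> Y) (W : X -> R) (c : R) (g : Y -> R) :
  measurable_fun setT phi -> measurable_fun setT W -> (forall x, 0 <= W x) ->
  0 <= c ->
  (forall A, measurable A ->
    (\int[mu]_x (W x * \1_A (phi x))%:E = c%:E * nu A)%E) ->
  measurable_fun setT g -> (forall y, 0 <= g y) ->
  (\int[mu]_x (W x * g (phi x))%:E = c%:E * \int[nu]_y (g y)%:E)%E.
Proof.
move=> mphi mW W0 c0 indW mg g0.
have mgE : measurable_fun setT (EFin \o g) by exact/measurable_EFinP.
pose g_ := nnsfun_approx measurableT mgE.
have g_cvg y : (EFin \o g_ ^~ y) @ \oo --> (g y)%:E.
  by apply: cvg_nnsfun_approx => // x _; rewrite lee_fin.
have g_nd y a b : (a <= b)%N -> g_ a y <= g_ b y.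
  by move=> ab; exact/lefP/nd_nnsfun_approx.
have step n : (\int[mu]_x (W x * g_ n (phi x))%:E
    = c%:E * \int[nu]_y (g_ n y)%:E)%E.
  under [in RHS]eq_integral do rewrite fimfunE -fsumEFin//.
  rewrite [in RHS]ge0_integral_fsum//; last 2 first.
    - by move=> r; exact/measurable_EFinP/measurableT_comp.
    - by move=> m x _; rewrite EFinM nnfun_muleindic_ge0.
  have decomp x : (W x * g_ n (phi x))%:E = (\sum_(r \in range (g_ n))
      (W x)%:E * (r * \1_(g_ n @^-1` [set r]) (phi x))%:E)%E.
    rewrite -ge0_mule_fsumr => [|r]; last exact: (nnfun_muleindic_ge0 (g_ n)).
    by rewrite EFinM fsumEFin// -fimfunE.
  under [LHS]eq_integral do rewrite decomp.
  rewrite [LHS]ge0_integral_fsum//; last 2 first.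
    - move=> r; apply/emeasurable_funM; first exact/measurable_EFinP.
      apply/measurable_EFinP/measurable_funM => //.
      by apply: (measurableT_comp _ mphi); exact: measurable_indic.
    - move=> m x _; apply: mule_ge0; first by rewrite lee_fin.
      exact: (nnfun_muleindic_ge0 (g_ n)).
  rewrite ge0_mule_fsumr; last first.
    by move=> r; apply: integral_ge0 => x _; rewrite EFinM nnfun_muleindic_ge0.
  apply: eq_fsbigr => r /[1!inE] -[y _ yr].
  have r0 : 0 <= r by rewrite -yr.
  transitivity (r%:E * \int[mu]_x
      (W x * \1_(g_ n @^-1` [set r]) (phi x))%:E)%E.
    rewrite -ge0_integralZl//; first last.
    - by move=> x _; rewrite lee_fin mulr_ge0.
    - apply/measurable_EFinP/measurable_funM => //.
      by apply: (measurableT_comp _ mphi); exact: measurable_indic.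
    by apply: eq_integral => x _; rewrite -!EFinM mulrCA.
  rewrite indW//.
  under [in RHS]eq_integral do rewrite EFinM.
  rewrite ge0_integralZl//; last exact/measurable_EFinP.
  by rewrite integral_indic// setIT muleCA.
transitivity (limn (fun n => \int[mu]_x (W x * g_ n (phi x))%:E)%E).
  rewrite -monotone_convergence//.
  - apply: eq_integral => x _; apply/esym/cvg_lim => //.
    under eq_fun do rewrite EFinM.
    rewrite EFinM; apply: cvgeZl => //; exact: g_cvg.
  - move=> n; apply/measurable_EFinP/measurable_funM => //.
    by apply: (measurableT_comp _ mphi).
  - by move=> n x _; rewrite lee_fin mulr_ge0.
  - by move=> x _ a b ab; rewrite lee_fin ler_wpM2l// g_nd.
under eq_fun do rewrite step.
rewrite limeMl//; last first.
  apply: ereal_nondecreasing_is_cvgn => a b ab; apply: ge0_le_integral => //.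
  - by move=> x _; rewrite lee_fin.
  - exact/measurable_EFinP.
  - exact/measurable_EFinP.
  - by move=> x _; rewrite lee_fin g_nd.
congr (_ * _)%E; rewrite -monotone_convergence//.
- apply: eq_integral => x _; apply/cvg_lim => //; exact: g_cvg.
- by move=> n; exact/measurable_EFinP.
- by move=> n x _; rewrite lee_fin.
- by move=> x _ a b ab; rewrite lee_fin g_nd.
Qed.

(** Independence is the case where every [h k] is an indicator.  The indicators
are traded for the functions [h k] one index at a time: the product over the
other indices serves as the weight [W] of [ge0_integral_weighted]. *)
Lemma expectation_prod_independent (dO dT : measure_display)
    (Omega : measurableType dO) (T : measurableType dT) (R : realType)
    (P : probability Omega R) (I : finType) (Y : I -> {RV P >-> T})
    (h : I -> T -> R) (e : I -> R) :
  mutually_independent Y ->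
  (forall k, measurable_fun setT (h k)) -> (forall k y, 0 <= h k y) ->
  (forall k, (\int[P]_w (h k (Y k w))%:E = (e k)%:E)%E) ->
  (\int[P]_w (\prod_k h k (Y k w))%:E = (\prod_k e k)%:E)%E.
Proof.
move=> indY.
have mhY (g : I -> T -> R) k : measurable_fun setT (g k) ->
    measurable_fun setT (fun w => g k (Y k w)).
  by move=> mg; exact: (measurableT_comp mg).
(* [s] lists the indices whose function is allowed not to be an indicator. *)
suff main (s : seq I) (g : I -> T -> R) (u : I -> R) :
    (forall k, measurable_fun setT (g k)) -> (forall k y, 0 <= g k y) ->
    (forall k, (\int[P]_w (g k (Y k w))%:E = (u k)%:E)%E) ->
    (forall k, k \notin s ->
      exists2 A, measurable A & g k = \1_A :> (T -> R)) ->
    (\int[P]_w (\prod_k g k (Y k w))%:E = (\prod_k u k)%:E)%E.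
  move=> mh h0 he; apply: (main (enum I)) => // k.
  by rewrite mem_enum.
elim: s g u => [|x s IH] g u mg g0 gu gs.
  have /choice[A AP] : forall k, exists A,
      measurable A /\ g k = \1_A :> (T -> R).
    by move=> k; have [//|A mA ->] := gs k; exists A.
  have mYA k : measurable (Y k @^-1` A k).
    by rewrite -[X in measurable X]setTI; apply: measurable_funPT => //;
      have [] := AP k.
  have uE k : (u k)%:E = P (Y k @^-1` A k).
    rewrite -gu -[in RHS](setIT (Y k @^-1` A k)) -integral_indic//.
    by apply: eq_integral => w _; rewrite (AP k).2 !indicE.
  rewrite -prodEFin; under eq_bigr do rewrite uE.
  have -> : (\prod_k P (Y k @^-1` A k))%E =
      P (\bigcap_(k in [set` [set: I]%SET]) (Y k @^-1` A k)).
    rewrite indY => [|k _]; last by have [] := AP k.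
    by apply: eq_bigl => k; rewrite inE.
  rewrite -[X in _ = P X]setIT -integral_indic//; last first.
    by apply: fin_bigcap_measurable => //; exact: finite_finset.
  apply: eq_integral => w _; congr EFin.
  rewrite indicE; case: (boolP (w \in _)) => [/set_mem wA|/negP wA].
    rewrite big1// => k _; rewrite (AP k).2 indicE mem_set//.
    by apply: (wA k); rewrite /= inE.
  have [k wAk] : exists k, ~ A k (Y k w).
    apply: contrapT => nk; apply: wA; rewrite inE => k _ /=.
    by apply: contrapT => wAk; apply: nk; exists k.
  by rewrite (bigD1 k)//= (AP k).2 indicE memNset// mul0r.
have u0 k : 0 <= u k.
  by rewrite -lee_fin -gu integral_ge0// => w _; rewrite lee_fin.
pose c := \prod_(k | k != x) u k.
pose W w := \prod_(k | k != x) g k (Y k w).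
have indW A : measurable A ->
    (\int[P]_w (W w * \1_A (Y x w))%:E = c%:E * distribution P (Y x) A)%E.
  move=> mA.
  have mYA : measurable (Y x @^-1` A).
    by rewrite -[X in measurable X]setTI; apply: measurable_funPT.
  pose g' k := if k == x then \1_A : T -> R else g k.
  pose u' k := if k == x then fine (P (Y x @^-1` A)) else u k.
  transitivity (\int[P]_w (\prod_k g' k (Y k w))%:E)%E.
    apply: eq_integral => w _; rewrite (bigD1 x)//= /g' eqxx mulrC.
    by congr (_ * _)%:E; apply: eq_bigr => k /negbTE ->.
  rewrite (IH g' u').
  - rewrite (bigD1 x)//= /u' eqxx EFinM muleC fineK ?fin_num_measure//.
    by congr (_%:E * _)%E; apply: eq_bigr => k /negbTE ->.
  - by move=> k; rewrite /g'; case: eqP.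
  - by move=> k y; rewrite /g'; case: eqP => // _; rewrite indicE.
  - move=> k; rewrite /g' /u'; case: eqP => // ->.
    rewrite fineK ?fin_num_measure// -[in RHS](setIT (Y x @^-1` A)).
    by rewrite -integral_indic//; apply: eq_integral => w _; rewrite !indicE.
  - move=> k ks; rewrite /g'; case: eqP => [_|/eqP kx]; first by exists A.
    by apply: gs; rewrite inE negb_or kx.
have -> : (\prod_k u k)%:E = (c%:E * \int[distribution P (Y x)]_y (g x y)%:E)%E.
  rewrite (bigD1 x)//= -/c EFinM muleC; congr (_ * _)%E.
  rewrite -gu ge0_integral_distribution//; first exact/measurable_EFinP.
  by move=> y; rewrite lee_fin.
rewrite -(@ge0_integral_weighted _ _ _ _ _ P _ (Y x) W c)//.
- by apply: eq_integral => w _; rewrite (bigD1 x)//= mulrC.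
- rewrite /W; under eq_fun do rewrite -big_filter.
  by apply: measurable_prod => k _; exact: mhY.
- by move=> w; apply: prodr_ge0 => k _.
- by apply: prodr_ge0 => k _.
Qed.

(** The joint law of [X] and [Y] is the product of their laws, since the two
agree on rectangles; Tonelli's theorem then applies. *)
Lemma expectation_independent_pair (dO d1 d2 : measure_display)
    (Omega : measurableType dO) (T1 : measurableType d1)
    (T2 : measurableType d2) (R : realType) (P : probability Omega R)
    (X : {RV P >-> T1}) (Y : {RV P >-> T2}) (h : T1 * T2 -> \bar R) :
  (forall A B, measurable A -> measurable B ->
    P (X @^-1` A `&` Y @^-1` B) = (P (X @^-1` A) * P (Y @^-1` B))%E) ->
  measurable_fun setT h -> (forall z, (0 <= h z)%E) ->
  (\int[P]_w h (X w, Y w) =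
   \int[distribution P X]_x \int[distribution P Y]_y h (x, y))%E.
Proof.
move=> indep mh h0.
pose Zf w := (X w, Y w).
have mZf : measurable_fun setT Zf by exact: measurable_fun_pair.
pose mZ := isMeasurableFun.Build _ _ _ _ Zf mZf.
pose Z : {RV P >-> (T1 * T2)%type} := HB.pack Zf mZ.
transitivity (\int[distribution P Z]_z h z)%E.
  by rewrite ge0_integral_distribution.
transitivity (\int[(distribution P X \x distribution P Y)%E]_z h z)%E.
  apply: eq_measure_integral => /= A mA _; apply/esym.
  by apply: product_measure_unique => // B C mB mC; rewrite -indep.
exact: fubini_tonelli1.
Qed.

Lemma mutually_independent_pair (dO dT : measure_display)
    (Omega : measurableType dO) (T : measurableType dT) (R : realType)
    (P : probability Omega R) (I : finType) (X : I -> {RV P >-> T})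
    (i j : I) (A B : set T) :
  mutually_independent X -> i != j -> measurable A -> measurable B ->
  P (X i @^-1` A `&` X j @^-1` B) = (P (X i @^-1` A) * P (X j @^-1` B))%E.
Proof.
move=> indX ij mA mB.
pose C k := if k == i then A else B.
have Ci : C i = A by rewrite /C eqxx.
have Cj : C j = B by rewrite /C eq_sym (negbTE ij).
have := indX [set i; j]%SET C.
rewrite big_setU1 ?inE//= big_set1 Ci Cj => <-; last first.
  by move=> k _; rewrite /C; case: ifP.
congr (P _); apply/seteqP; split => [w [wA wB] k /=|w wAB].
  by rewrite !inE => /orP[]/eqP ->; rewrite ?Ci ?Cj.
by split; [have := wAB i|have := wAB j];
  rewrite /= !inE eqxx ?orbT ?Ci ?Cj; exact.
Qed.

(** * Laplace transform of a squared norm of Gaussian vectors *)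

(** [normal_prob] is a measure for the sigma-algebra of [measurableTypeR R],
whereas the law of a real random variable lives on the canonical one of [R];
these have different displays, so the law is compared with [normal_prob] set by
set. *)
Lemma integral_normal_law (R : realType) (nu : {measure set R -> \bar R})
    (g : R -> R) :
  (forall A, measurable A -> nu A = normal_prob 0 1 A) ->
  measurable_fun setT g -> (forall x, 0 <= g x) ->
  (\int[nu]_x (g x)%:E =
   \int[lebesgue_measure]_x (normal_pdf 0 1 x * g x)%:E)%E.
Proof.
move=> nuE mg g0; apply/esym.
have mid : measurable_fun setT (idfun : measurableTypeR R -> R).
  by move=> _ A mA; rewrite setTI.
rewrite (@ge0_integral_weighted _ _ _ _ _ lebesgue_measure nu
  (idfun : measurableTypeR R -> R) (normal_pdf 0 1) 1)// ?mul1e//.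
- exact: measurable_normal_pdf.
- by move=> x; exact: normal_pdf_ge0.
- move=> A mA; rewrite mul1e nuE// /normal_prob [RHS]integral_mkcond.
  apply: eq_integral => x _; rewrite patchE indicE.
  by case: ifPn => _; rewrite ?mulr1 ?mulr0.
Qed.

(** Completing the square turns the integrand into a multiple of the density of
the normal law with variance [1 / (1 + 2 s b^2)].  The sign of [s] is free. *)
Lemma integral_normal_exp_sqr (R : realType)
    (nu : {measure set R -> \bar R}) (s a b : R) :
  (forall A, measurable A -> nu A = normal_prob 0 1 A) ->
  0 < 1 + 2 * s * b ^+ 2 ->
  (\int[nu]_x (expR (- s * (a + b * x) ^+ 2))%:E =
   ((Num.sqrt (1 + 2 * s * b ^+ 2))^-1 *
     expR (- s * a ^+ 2 / (1 + 2 * s * b ^+ 2)))%:E)%E.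
Proof.
move=> nuE; set q := 1 + _ => q0.
rewrite (integral_normal_law nuE); last 2 first.
- apply: measurableT_comp => //; apply: measurable_funM => //.
  apply: measurable_funX; apply: measurable_funD => //.
- by move=> x; exact: expR_ge0.
pose sg := (Num.sqrt q)^-1.
have sq0 : 0 < Num.sqrt q by rewrite sqrtr_gt0.
have sg0 : sg != 0 by rewrite invr_neq0// gt_eqF.
have sg2 : sg ^+ 2 = q^-1 by rewrite exprVn sqr_sqrtr// ltW.
pose mn := - (2 * s * a * b) / q.
transitivity (\int[lebesgue_measure]_x
    ((sg * expR (- s * a ^+ 2 / q))%:E * (normal_pdf mn sg x)%:E))%E.
  apply: eq_integral => x _; rewrite -EFinM; congr EFin.
  rewrite !normal_pdfE// /normal_peak /normal_fun.
  have -> : Num.sqrt (sg ^+ 2 * pi *+ 2) = sg * Num.sqrt (1 ^+ 2 * pi *+ 2).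
    rewrite expr1n mul1r -mulrnAr sqrtrM ?sqr_ge0// sqrtr_sqr ger0_norm//.
    by rewrite invr_ge0 ltW.
  rewrite invfM mulrAC mulrACA !mulrA mulfV// mul1r -!mulrA; congr (_ * _).
  rewrite -!expRD; congr expR.
  rewrite sg2 expr1n /mn.
  have q_neq0 : q != 0 by rewrite gt_eqF.
  by rewrite /q in q_neq0 *; field.
rewrite ge0_integralZl//=.
- by rewrite integral_normal_pdf mule1.
- by apply/measurable_EFinP; exact: measurable_normal_pdf.
- by move=> x _; rewrite lee_fin normal_pdf_ge0.
- by rewrite lee_fin mulr_ge0 ?expR_ge0// invr_ge0 ltW.
Qed.

Section laplace.
Context (dO : measure_display) (Omega : measurableType dO) (R : realType)
  (P : probability Omega R) (d : nat).
Implicit Types X Y : {RV P >-> d.-tuple R}.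

Lemma gaussian_expectation_exp_sqr X (s b : R) (a : 'I_d -> R) :
  standard_gaussian X -> 0 < 1 + 2 * s * b ^+ 2 ->
  (\int[P]_w (\prod_k expR (- s * (a k + b * tnth (X w) k) ^+ 2))%:E =
   ((Num.sqrt (1 + 2 * s * b ^+ 2))^-1 ^+ d *
     expR (- s * (\sum_k a k ^+ 2) / (1 + 2 * s * b ^+ 2)))%:E)%E.
Proof.
move=> [indX gX] q0; set q := 1 + _.
have mh k : measurable_fun setT
    (fun y : R => expR (- s * (a k + b * y) ^+ 2)).
  apply: measurableT_comp => //; apply: measurable_funM => //.
  by apply: measurable_funX; apply: measurable_funD.
rewrite (@expectation_prod_independent _ _ _ _ _ _ _ _
  (fun k (y : R) => expR (- s * (a k + b * y) ^+ 2))
  (fun k => (Num.sqrt q)^-1 * expR (- s * a k ^+ 2 / q)) indX)//; last first.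
  move=> k.
  rewrite -(@ge0_integral_distribution _ _ _ _ _ P (vcoord X k)
    (fun y => (expR (- s * (a k + b * y) ^+ 2))%:E))//; last first.
    exact/measurable_EFinP.
  by rewrite (integral_normal_exp_sqr _ (gX k)).
congr EFin; rewrite big_split/= prodr_const card_ord; congr (_ * _).
by rewrite -expR_sum mulr_sumr mulr_suml.
Qed.

(** Integrating over [Y] alone leaves a function of [X] of the same shape, with
[s] replaced by [s / (1 + 2 s b^2)], so the one-vector formula applies again. *)
Lemma gaussian_pair_laplace X Y (s b c : R) (a : 'I_d -> R) :
  standard_gaussian X -> standard_gaussian Y ->
  (forall A B, measurable A -> measurable B ->
    P (X @^-1` A `&` Y @^-1` B) = (P (X @^-1` A) * P (Y @^-1` B))%E) ->
  0 < 1 + 2 * s * b ^+ 2 -> 0 < 1 + 2 * s * (b ^+ 2 + c ^+ 2) ->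
  (\int[P]_w (expR (- s *
      \sum_k (a k + c * tnth (X w) k + b * tnth (Y w) k) ^+ 2))%:E =
   ((Num.sqrt (1 + 2 * s * (b ^+ 2 + c ^+ 2)))^-1 ^+ d *
     expR (- s * (\sum_k a k ^+ 2) / (1 + 2 * s * (b ^+ 2 + c ^+ 2))))%:E)%E.
Proof.
move=> gX gY indep q0 v0; set v := 1 + _ in v0 *.
pose q := 1 + 2 * s * b ^+ 2; rewrite -/q in q0.
have q_neq0 : q != 0 by rewrite gt_eqF.
pose h (z : d.-tuple R * d.-tuple R) := expR (- s *
  \sum_k (a k + c * tnth z.1 k + b * tnth z.2 k) ^+ 2).
have mh : measurable_fun setT h.
  apply: measurableT_comp => //; apply: measurable_funM => //.
  apply: measurable_sum => k; apply: measurable_funX.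
  apply: measurable_funD; first apply: measurable_funD => //.
    apply: measurable_funM => //.
    by apply: (measurableT_comp (measurable_tnth k)).
  apply: measurable_funM => //.
  by apply: (measurableT_comp (measurable_tnth k)).
transitivity (\int[P]_w (h (X w, Y w))%:E)%E; first by [].
rewrite (@expectation_independent_pair _ _ _ _ _ _ _ _ X Y (EFin \o h))//;
  last 2 first.
- exact/measurable_EFinP.
- by move=> z; rewrite lee_fin expR_ge0.
have qv : v / q = 1 + 2 * (s / q) * c ^+ 2.
  by rewrite /v /q in q_neq0 *; field.
have vq0 : 0 < 1 + 2 * (s / q) * c ^+ 2 by rewrite -qv divr_gt0.
transitivity (\int[distribution P X]_x (((Num.sqrt q)^-1 ^+ d)%:E *
    (expR (- (s / q) * (\sum_k (a k + c * tnth x k) ^+ 2)))%:E))%E.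
  apply: eq_integral => x _.
  rewrite ge0_integral_distribution//=; last 2 first.
  - apply/measurable_EFinP; apply: (measurableT_comp mh).
    exact: measurable_fun_pair.
  - by move=> y; rewrite lee_fin expR_ge0.
  under eq_integral do rewrite /h/= mulr_sumr expR_sum.
  rewrite (gaussian_expectation_exp_sqr (fun k => a k + c * tnth x k) gY)//.
  by rewrite -EFinM -/q !mulNr [s * _ / q]mulrAC.
have mG : measurable_fun setT (fun x : d.-tuple R =>
    (expR (- (s / q) * \sum_k (a k + c * tnth x k) ^+ 2))%:E).
  apply/measurable_EFinP; apply: measurableT_comp => //.
  apply: measurable_funM => //; apply: measurable_sum => k.
  apply: measurable_funX; apply: measurable_funD => //.
  by apply: measurable_funM => //; exact: measurable_tnth.
rewrite ge0_integralZl// ge0_integral_distribution//=.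
under eq_integral do rewrite mulr_sumr expR_sum.
rewrite (gaussian_expectation_exp_sqr a gX)// -qv -EFinM; congr EFin.
rewrite [LHS]mulrA -exprMn; congr (_ ^+ _ * expR _).
  by rewrite -invfM -sqrtrM ?ltW// mulrC divfK.
by rewrite invfM invrK -!mulNr -[RHS]mulrA; field; rewrite q_neq0 gt_eqF.
Qed.
End laplace.

(** * Chi-square tails *)

Lemma probability_le_integral_expR (dO : measure_display)
    (Omega : measurableType dO) (R : realType) (P : probability Omega R)
    (f : Omega -> R) (A : set Omega) :
  measurable_fun setT f -> measurable A -> (forall w, A w -> 0 <= f w) ->
  (P A <= \int[P]_w (expR (f w))%:E)%E.
Proof.
move=> mf mA f0; rewrite -[in leLHS](setIT A) -integral_indic//.
apply: ge0_le_integral => //.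
- exact/measurable_EFinP/measurable_indic.
- by apply/measurable_EFinP; apply: measurableT_comp.
move=> w _; rewrite lee_fin indicE; case: (boolP (w \in A)) => [|_].
  by rewrite inE => /f0 fw; rewrite (le_trans _ (expR_ge1Dx _))// lerDl.
exact: expR_ge0.
Qed.

(** This crude form of [ln x <= x - 1] replaces the sharper expansion of the
logarithm that is customary for chi-square tails. *)
Lemma inv_sqrt_le_expR (R : realType) (q : R) :
  0 < q -> (Num.sqrt q)^-1 <= expR ((q^-1 - 1) / 2).
Proof.
move=> q0; rewrite -(@ler_pXn2r _ 2%N)//
  ?nnegrE ?invr_ge0 ?sqrtr_ge0 ?expR_ge0//.
rewrite exprVn (sqr_sqrtr (ltW q0)) -expRM_natl mulrC divfK//.
by rewrite (le_trans _ (expR_ge1Dx _))// addrC subrK.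
Qed.

Section tails.
Context (dO : measure_display) (Omega : measurableType dO) (R : realType)
  (P : probability Omega R) (d : nat) (X Y : {RV P >-> d.-tuple R}).
Context (d_gt0 : (0 < d)%N)
  (gX : standard_gaussian X) (gY : standard_gaussian Y)
  (indep : forall A B, measurable A -> measurable B ->
    P (X @^-1` A `&` Y @^-1` B) = (P (X @^-1` A) * P (Y @^-1` B))%E).
Context (a : 'I_d -> R) (b c : R) (v_gt0 : 0 < b ^+ 2 + c ^+ 2).

Let v := b ^+ 2 + c ^+ 2.
Let D w := \sum_k (a k + c * tnth (X w) k + b * tnth (Y w) k) ^+ 2.
Let K := \sum_k a k ^+ 2.

Lemma measurable_sqr_norm_comb : measurable_fun setT D.
Proof.
apply: measurable_sum => k; apply: measurable_funX.
apply: measurable_funD; first apply: measurable_funD => //.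
  apply: measurable_funM => //; exact: (@measurable_vcoord _ _ _ P d X k).
apply: measurable_funM => //; exact: (@measurable_vcoord _ _ _ P d Y k).
Qed.

(** A positive [s] serves lower tails of [D], a negative one upper tails. *)
Lemma gaussian_pair_chernoff (s t : R) (A : set Omega) :
  measurable A -> 0 < 1 + 2 * s * v -> (forall w, A w -> s * D w <= t) ->
  (P A <= (expR t * ((Num.sqrt (1 + 2 * s * v))^-1 ^+ d *
     expR (- s * K / (1 + 2 * s * v))))%:E)%E.
Proof.
move=> mA q0 At.
(* For [s < 0] this follows from the hypothesis on [v], as [v >= b^2]. *)
have b0 : 0 < 1 + 2 * s * b ^+ 2.
  have [s0|/ltW s0] := leP 0 s.
    by rewrite ltr_pwDl// mulr_ge0 ?sqr_ge0// mulr_ge0.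
  rewrite (lt_le_trans q0)// lerD2l ler_wnM2l ?lerDl ?sqr_ge0//.
  by rewrite mulr_ge0_le0.
have mD := measurable_sqr_norm_comb.
rewrite (le_trans (@probability_le_integral_expR _ _ _ P
  (fun w => t + (- s * D w)) A _ _ _))//.
- by apply: measurable_funD => //; apply: measurable_funM.
- by move=> w /At; rewrite mulNr subr_ge0.
under eq_integral do rewrite expRD EFinM.
rewrite ge0_integralZl//=; last first.
- apply/measurable_EFinP; apply: measurableT_comp => //.
  exact: measurable_funM.
by rewrite (gaussian_pair_laplace _ gX gY)// EFinM.
Qed.

Lemma gaussian_pair_chernoff_exp (s t : R) (A : set Omega) :
  measurable A -> 0 < 1 + 2 * s * v -> (forall w, A w -> s * D w <= t) ->
  (P A <= (expR (t + d%:R * (((1 + 2 * s * v)^-1 - 1) / 2)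
     - s * K / (1 + 2 * s * v)))%:E)%E.
Proof.
move=> mA q0 At; apply: (le_trans (gaussian_pair_chernoff mA q0 At)).
rewrite lee_fin -addrA !expRD ler_wpM2l ?expR_ge0// -!mulNr.
rewrite ler_wpM2r ?expR_ge0// expRM_natl.
rewrite lerXn2r ?nnegrE ?invr_ge0 ?sqrtr_ge0 ?expR_ge0//.
exact: inv_sqrt_le_expR.
Qed.

Lemma central_upper_tail (l : R) : (forall k, a k = 0) -> 0 <= l ->
  (P [set w | (v * (Num.sqrt d%:R + l) ^+ 2 <= D w)%R]
    <= (expR (- (l ^+ 2 / 2)))%:E)%E.
Proof.
move=> a0 l0; set al := Num.sqrt d%:R.
have al0 : 0 < al by rewrite sqrtr_gt0 ltr0n.
have al2 : al ^+ 2 = d%:R by rewrite sqr_sqrtr.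
have v0 : v != 0 by rewrite gt_eqF.
have al_neq0 : al != 0 by rewrite gt_eqF.
have all_gt0 : 0 < al + l by rewrite ltr_pwDl.
have all0 : al + l != 0 by rewrite gt_eqF.
(* This [s] makes the exponent of the Chernoff bound equal to [- l^2 / 2]. *)
pose s := - (l / (2 * (al + l) * v)).
have s_le0 : s <= 0.
  by rewrite oppr_le0 divr_ge0// !mulr_ge0// ltW.
have qE : 1 + 2 * s * v = al / (al + l).
  by rewrite /s; field; rewrite v0 all0.
have K0 : K = 0 by rewrite /K big1// => k _; rewrite a0 expr0n.
apply: (le_trans
  (@gaussian_pair_chernoff_exp s (- (l * (al + l) / 2)) _ _ _ _)).
- by rewrite -[X in measurable X]setTI; apply: measurable_fun_le => //;
    exact: measurable_sqr_norm_comb.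
- by rewrite qE divr_gt0.
- move=> w /= Dw; apply: (le_trans (ler_wnM2l s_le0 Dw)).
  by rewrite le_eqVlt; apply/orP; left; apply/eqP; rewrite /s; field;
    rewrite v0 all0.
rewrite qE K0 mulr0 mul0r subr0 -al2 lee_fin ler_expR le_eqVlt; apply/orP; left.
by apply/eqP; field; rewrite al_neq0 all0.
Qed.

Lemma noncentral_lower_tail (l t : R) : 0 <= l -> 0 < t ->
  (t + l) ^+ 2 <= K / v + d%:R ->
  (P [set w | (D w <= v * t ^+ 2)%R] <= (expR (- (l ^+ 2 / 2)))%:E)%E.
Proof.
move=> l0 t0 tl.
have v0 : v != 0 by rewrite gt_eqF.
have t_neq0 : t != 0 by rewrite gt_eqF.
have tl_gt0 : 0 < t + l by rewrite ltr_pwDl.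
have tl_neq0 : t + l != 0 by rewrite gt_eqF.
(* The minimizer of [2 s t^2 + l^2 / (2 s)], up to the factor [v]. *)
pose s := l / (2 * t * v).
have s_ge0 : 0 <= s by rewrite divr_ge0// !mulr_ge0// ltW.
have qE : 1 + 2 * s * v = (t + l) / t.
  by rewrite /s; field; rewrite v0 t_neq0.
apply: (le_trans (@gaussian_pair_chernoff_exp s (l * t / 2) _ _ _ _)).
- by rewrite -[X in measurable X]setTI; apply: measurable_fun_le => //;
    exact: measurable_sqr_norm_comb.
- by rewrite qE divr_gt0.
- move=> w /= Dw; apply: (le_trans (ler_wpM2l s_ge0 Dw)).
  by rewrite le_eqVlt; apply/orP; left; apply/eqP; rewrite /s; field;
    rewrite v0 t_neq0.
rewrite qE lee_fin ler_expR.
have -> : l * t / 2 + d%:R * ((((t + l) / t)^-1 - 1) / 2)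
    - s * K / ((t + l) / t) =
    l / (2 * (t + l)) * (t * (t + l) - (K / v + d%:R)).
  by rewrite /s; field; rewrite v0 t_neq0 tl_neq0.
have -> : - (l ^+ 2 / 2) = l / (2 * (t + l)) * (t * (t + l) - (t + l) ^+ 2).
  by field.
by rewrite ler_wpM2l ?lerD2l ?lerN2// divr_ge0// mulr_ge0// ltW.
Qed.

(** The logarithm of a zero distance is minus infinity, and two matchings
sharing such a pair would tie.  A large [s] in the Chernoff bound makes the
probability of this as small as desired. *)
Lemma sqr_norm_comb_small_ball (L : R) : 0 <= L ->
  (P [set w | (D w <= 0)%R] <= (expR (- L))%:E)%E.
Proof.
move=> L0; pose s := (expR (2 * L) - 1) / (2 * v).
have v0 : v != 0 by rewrite gt_eqF.
have qE : 1 + 2 * s * v = expR (2 * L) by rewrite /s; field.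
have s_ge0 : 0 <= s.
  have : 1 <= expR (2 * L) by rewrite -expR0 ler_expR mulr_ge0.
  by move=> ?; rewrite divr_ge0 ?subr_ge0// mulr_ge0// ltW.
apply: (le_trans (@gaussian_pair_chernoff s 0 _ _ _ _)).
- by rewrite -[X in measurable X]setTI; apply: measurable_fun_le => //;
    exact: measurable_sqr_norm_comb.
- by rewrite qE expR_gt0.
- by move=> w /= Dw; rewrite mulr_ge0_le0.
rewrite qE expR0 mul1r lee_fin.
have -> : (Num.sqrt (expR (2 * L)))^-1 = expR (- L).
  by rewrite mulrC expRM_natr sqrtr_sqr ger0_norm ?expR_ge0// expRN.
rewrite -[leRHS]mulr1 ler_pM ?exprn_ge0 ?expR_ge0//.
  by rewrite -[leRHS]expr1 ler_wiXn2l ?expR_ge0// -expR0 ler_expR oppr_le0.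
rewrite -expR0 ler_expR !mulNr oppr_le0 divr_ge0 ?expR_ge0// mulr_ge0//.
by apply: sumr_ge0 => k _; rewrite sqr_ge0.
Qed.

End tails.

(** * The matching map as strict minimizer *)

(** Put [a = sqrt d], [l = sqrt (2 L)], [rho = sqrt r], and let [A], [2 B] and
[2 C] be the three terms of the threshold.  Then [B^2 >= rho^2 a l] and
[C^2 = rho^2 l^2], so that [A^2 + 4 B^2 + 4 C^2 + a^2], which [K^2 + d]
dominates, is at least the square of [rho a + (rho + 1) l], coefficient by
coefficient.  Taking [r = 1] gives the condition between inliers. *)
Lemma separation_suffices (R : realType) (d : nat) (r L K : R) :
  1 <= r -> 0 <= L ->
  Num.sqrt (2 * (r - 1) * d%:R) + 2 * (4 * r ^+ 2 * d%:R * L) `^ (1 / 4)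
    + 2 * Num.sqrt (2 * r * L) <= K ->
  (Num.sqrt r * (Num.sqrt d%:R + Num.sqrt (2 * L)) + Num.sqrt (2 * L)) ^+ 2
    <= K ^+ 2 + d%:R.
Proof.
move=> r1 L0; have r0 : 0 <= r by rewrite (le_trans ler01).
set A := Num.sqrt (2 * _ * _); set B := _ `^ _; set C := Num.sqrt (2 * r * L).
set rho := Num.sqrt r; set a := Num.sqrt d%:R; set l := Num.sqrt (2 * L) => ABC.
have A0 : 0 <= A by rewrite sqrtr_ge0.
have B0 : 0 <= B by rewrite powR_ge0.
have C0 : 0 <= C by rewrite sqrtr_ge0.
have a0 : 0 <= a by rewrite sqrtr_ge0.
have l0 : 0 <= l by rewrite sqrtr_ge0.
have rho2 : rho ^+ 2 = r by rewrite sqr_sqrtr.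
have a2 : a ^+ 2 = d%:R by rewrite sqr_sqrtr.
have l2 : l ^+ 2 = 2 * L by rewrite sqr_sqrtr// mulr_ge0.
have A2 : A ^+ 2 = 2 * (r - 1) * d%:R.
  by rewrite sqr_sqrtr// !mulr_ge0// subr_ge0.
have C2 : C ^+ 2 = r * l ^+ 2 by rewrite sqr_sqrtr ?mulr_ge0// l2; ring.
have B2 : r * (a * l) <= B ^+ 2.
  have -> : B ^+ 2 = Num.sqrt (4 * r ^+ 2 * d%:R * L).
    rewrite -powR_mulrn// -powRrM -powR12_sqrt ?mulr_ge0 ?sqr_ge0//.
    by congr (_ `^ _); field.
  rewrite -[leLHS]ger0_norm ?mulr_ge0// -sqrtr_sqr ler_wsqrtr//.
  rewrite !exprMn a2 l2.
  by have := mulr_ge0 (mulr_ge0 (sqr_ge0 r) (ler0n R d)) L0; lra.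
have rho1 : 1 <= rho by rewrite -sqrtr1 ler_wsqrtr.
have K2 : A ^+ 2 + 4 * B ^+ 2 + 4 * C ^+ 2 <= K ^+ 2.
  apply: (@le_trans _ _ ((A + 2 * B + 2 * C) ^+ 2)); last first.
    rewrite ler_pXn2r ?nnegrE ?addr_ge0 ?mulr_ge0//.
    by rewrite (le_trans _ ABC) ?addr_ge0 ?mulr_ge0.
  have := mulr_ge0 A0 B0; have := mulr_ge0 A0 C0; have := mulr_ge0 B0 C0.
  nra.
apply: (le_trans _ (lerD K2 (lexx _))).
rewrite A2 C2 -a2 -rho2.
have al0 : 0 <= a * l by rewrite mulr_ge0.
have h1 : rho <= rho ^+ 2 by rewrite expr2 ler_peMl// (le_trans ler01).
have h2 : 0 <= (rho ^+ 2 - rho) * (a * l) by rewrite mulr_ge0// subr_ge0.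
have h3 : 0 <= (rho ^+ 2 - 1) * a ^+ 2.
  by rewrite mulr_ge0 ?sqr_ge0// subr_ge0 (le_trans rho1).
have h4 : 0 <= (4 * rho ^+ 2 - (rho + 1) ^+ 2) * l ^+ 2.
  by rewrite mulr_ge0 ?sqr_ge0//; nra.
rewrite -rho2 in B2; nra.
Qed.

(** The images [A] of [pi] and [B] of [pistar] have the same cardinality, hence
so have [A \ B] and [B \ A]; on the former each term is at least the maximum
of [f], thanks to the added [rho]. *)
Lemma sum_image_le (R : realDomainType) (n m : nat) (f : 'I_m -> R) (rho : R)
    (pi pistar : {ffun 'I_n -> 'I_m}) :
  injective pi -> injective pistar -> (forall j k, f j <= f k + rho) ->
  \sum_i f (pistar i) <=
  \sum_i (f (pi i) + (if pi i \in outliers pistar then rho else 0)).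
Proof.
move=> pi_inj ps_inj frho.
set A := (pi @: [set: 'I_n])%SET; set B := (pistar @: [set: 'I_n])%SET.
have cAB : #|A| = #|B| by rewrite !card_imset.
have sum_im (g : 'I_m -> R) (p : {ffun 'I_n -> 'I_m}) : injective p ->
    \sum_i g (p i) = \sum_(j in (p @: [set: 'I_n])%SET) g j.
  move=> p_inj; rewrite big_imset/=; last by move=> ? ? _ _; exact: p_inj.
  by apply: eq_bigl => i; rewrite inE.
rewrite (sum_im f)// -/B.
rewrite (sum_im
  (fun j => f j + (if j \in outliers pistar then rho else 0)) pi)//.
rewrite -/A.
rewrite (big_setID A)/= [leRHS](big_setID B)/= finset.setIC; apply: lerD.
  apply: ler_sum => j; rewrite inE => /andP[_ jB].
  by rewrite /outliers -/B inE jB addr0.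
have cD : #|(A :\: B)%SET| = #|(B :\: A)%SET|.
  by rewrite !cardsD cAB finset.setIC.
have [BA0|/finset.set0Pn[k0 k0BA]] := eqVneq (B :\: A)%SET finset.set0.
  have -> : (A :\: B)%SET = finset.set0.
    by apply: cards0_eq; rewrite cD BA0 cards0.
  by rewrite BA0 !big_set0.
have [j0 fj0] : exists j0, forall j, f j <= f j0.
  exists [arg max_(j > k0) f j]%O => j.
  by case: arg_maxP => // i _; exact.
apply: (@le_trans _ _ (\sum_(j in (B :\: A)%SET) f j0)); first exact: ler_sum.
rewrite sumr_const -cD -sumr_const; apply: ler_sum => j.
by rewrite inE => /andP[jB _]; rewrite /outliers -/B inE jB.
Qed.

Lemma noise_ratio_ge (R : realType) (m : nat) (sigma : 'I_m -> R) j k :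
  sigma j / sigma k <= noise_ratio sigma.
Proof. exact: (@le_bigmax_cond _ _ _ _ (j, k)). Qed.

(** The outlier factor [noise_ratio sigma] in the lower bound on [D] is exactly
the price of exchanging the noise level of one inlier for that of an outlier. *)
Lemma LSL_strict_min (R : realType) (n m : nat) (sigma : 'I_m -> R)
    (pi pistar : {ffun 'I_n -> 'I_m}) (D : 'I_n -> 'I_m -> R) (t : R) :
  (forall j, 0 < sigma j) -> injective pi -> injective pistar ->
  pi <> pistar -> 0 < t -> 1 <= noise_ratio sigma ->
  (forall i, 0 < D i (pistar i) < 2 * sigma (pistar i) ^+ 2 * t) ->
  (forall i j, j != pistar i ->
    (sigma (pistar i) ^+ 2 + sigma j ^+ 2) *
      ((if j \in outliers pistar then noise_ratio sigma else 1) * t)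
    < D i j) ->
  \sum_i ln (D i (pistar i)) < \sum_i ln (D i (pi i)).
Proof.
move=> sigma0 pi_inj ps_inj pineq t0 r1 Dmatch Dother.
set r := noise_ratio sigma in r1 Dother.
have r0 : 0 < r by rewrite (lt_le_trans ltr01).
pose f j := ln (sigma j).
pose g j := f j + (if j \in outliers pistar then ln r else 0).
have fg : \sum_i f (pistar i) <= \sum_i g (pi i).
  apply: sum_image_le => // j k; rewrite /f -lnM ?posrE//.
  rewrite ler_ln ?posrE ?mulr_gt0// mulrC -ler_pdivrMr//.
  exact: noise_ratio_ge.
have step i : pi i != pistar i ->
    ln (D i (pistar i)) + g (pi i) < ln (D i (pi i)) + f (pistar i).
  move=> pii; have /andP[D0 Dlt] := Dmatch i; have Dgt := Dother _ _ pii.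
  set q := if _ then _ else _ in Dgt.
  have q0 : 0 < q by rewrite /q; case: ifP.
  have -> : g (pi i) = ln (sigma (pi i) * q).
    by rewrite /g /f /q; case: ifP => _; rewrite ?mulr1 ?addr0// lnM ?posrE.
  have D'0 : 0 < D i (pi i).
    by apply: lt_trans Dgt; rewrite !mulr_gt0// addr_gt0// exprn_gt0.
  rewrite /f -!lnM ?posrE ?mulr_gt0// ltr_ln ?posrE ?mulr_gt0//.
  set s := sigma (pistar i) in Dlt Dgt *; set u := sigma (pi i) in Dgt *.
  have s0 : 0 < s by exact: sigma0.
  have u0 : 0 < u by exact: sigma0.
  apply: (@lt_trans _ _ (2 * s ^+ 2 * t * (u * q))).
    by rewrite ltr_pM2r// mulr_gt0.
  (* The inequality [2 s u <= s^2 + u^2] makes the noise levels of [i] and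
     [pi i] separate, so that they telescope in the sum over [i]. *)
  apply: (@le_lt_trans _ _ ((s ^+ 2 + u ^+ 2) * (q * t) * s)).
    have -> : 2 * s ^+ 2 * t * (u * q) = (2 * s * u) * (q * t * s) by ring.
    rewrite -[leRHS]mulrA.
    rewrite ler_pM2r ?mulr_gt0//.
    by rewrite -subr_ge0 (_ : _ - _ = (s - u) ^+ 2) ?sqr_ge0//; ring.
  by rewrite ltr_pM2r.
have [i0 pi0] : exists i, pi i != pistar i.
  apply/existsP; rewrite -negb_forall; apply/negP => /forallP pieq.
  by apply: pineq; apply/ffunP => i; exact/eqP.
have stepw i : ln (D i (pistar i)) + g (pi i) <= ln (D i (pi i)) + f (pistar i).
  have [pii|/step/ltW//] := eqVneq (pi i) (pistar i).
  rewrite pii /g; case: ifPn => [|_]; last by rewrite addr0.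
  by rewrite inE imset_f ?inE.
have lt_sum : \sum_i (ln (D i (pistar i)) + g (pi i)) <
    \sum_i (ln (D i (pi i)) + f (pistar i)).
  rewrite (bigD1 i0)//= [ltRHS](bigD1 i0)//= ltr_leD ?step//.
  exact: ler_sum.
rewrite big_split [ltRHS]big_split/= in lt_sum.
by rewrite -(ltrD2r (\sum_i g (pi i))) (lt_le_trans lt_sum)// lerD2l.
Qed.

(** * The observed squared distances *)

Lemma finite_union_bound (dO : measure_display) (Omega : measurableType dO)
    (R : realType) (mu : {measure set Omega -> \bar R}) (I : finType)
    (B : I -> set Omega) (e : R) :
  (forall p, measurable (B p)) -> (forall p, (mu (B p) <= e%:E)%E) ->
  measurable (\bigcup_p B p) /\
  (mu (\bigcup_p B p) <= (#|I|%:R * e)%:E)%E.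
Proof.
move=> mB Be; rewrite mulr_natl -sumr_const -sumEFin.
have -> : \bigcup_p B p = \big[setU/set0]_(p : I) B p.
  rewrite -bigcup_seq; apply/seteqP; split => w [p _ Bw]; exists p => //.
  by rewrite /= mem_index_enum.
elim/big_rec2 : _ => [|p y U _ [mU Uy]]; first by rewrite measure0.
split; first exact: measurableU.
by apply: (le_trans (measureU2 mu (mB p) mU)); apply: leeD; [exact: Be|].
Qed.

Section observation.
Context (R : realType) (n m d : nat) (dO : measure_display)
  (Omega : measurableType dO) (P : probability Omega R)
  (theta : 'I_m -> d.-tuple R) (sigma : 'I_m -> R)
  (pistar : {ffun 'I_n -> 'I_m})
  (xi : 'I_n -> {RV P >-> d.-tuple R}) (xis : 'I_m -> {RV P >-> d.-tuple R}).

Lemma measurable_observe :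
  measurable_fun setT (observe theta sigma pistar xi xis).
Proof.
have coord (X : {RV P >-> d.-tuple R}) (a b : R) k :
    measurable_fun setT (fun w => a + b * tnth (X w) k).
  apply: measurable_funD => //; apply: measurable_funM => //.
  exact: (measurable_vcoord X k).
rewrite /observe; apply: measurable_fun_pair; apply/measurable_fun_tnthP => i;
    apply/measurable_fun_tnthP => k.
- apply: (eq_measurable_fun (fun w =>
    tnth (theta (pistar i)) k + sigma (pistar i) * tnth (xi i w) k)).
    by move=> w _; rewrite /= !tnth_mktuple.
  exact: coord.
- apply: (eq_measurable_fun (fun w =>
    tnth (theta i) k + sigma i * tnth (xis i w) k)).
    by move=> w _; rewrite /= !tnth_mktuple.
  exact: coord.
Qed.

(** The shape [a + c * x + b * y] is the one of the Laplace transform above. *)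
Definition obs_sqr_dist (i : 'I_n) (j : 'I_m) (w : Omega) : R :=
  \sum_k ((tnth (theta (pistar i)) k - tnth (theta j) k)
    + sigma (pistar i) * tnth (xi i w) k + (- sigma j) * tnth (xis j w) k) ^+ 2.

Lemma eucl_dist_observe i j w :
  let x := observe theta sigma pistar xi xis w in
  eucl_dist (tnth x.1 i) (tnth x.2 j) ^+ 2 = obs_sqr_dist i j w.
Proof.
rewrite /eucl_dist sqr_sqrtr; last by apply: sumr_ge0 => k _; rewrite sqr_ge0.
by apply: eq_bigr => k _; rewrite !tnth_mktuple; congr (_ ^+ 2); ring.
Qed.

Lemma LSL_objective_observe (pi : {ffun 'I_n -> 'I_m}) w :
  (forall i, 0 < obs_sqr_dist i (pi i) w) ->
  LSL_objective (observe theta sigma pistar xi xis w) pi =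
  (\sum_i ln (obs_sqr_dist i (pi i) w))%:E.
Proof.
move=> D0; rewrite /LSL_objective -sumEFin; apply: eq_bigr => i _.
by rewrite eucl_dist_observe lne_EFin.
Qed.

End observation.

Lemma sep_sqr (R : realType) (m d : nat) (theta : 'I_m -> d.-tuple R)
    (sigma : 'I_m -> R) i j :
  sep theta sigma i j ^+ 2 =
  (\sum_k (tnth (theta i) k - tnth (theta j) k) ^+ 2)
    / (sigma i ^+ 2 + sigma j ^+ 2).
Proof.
rewrite /sep /eucl_dist exprMn exprVn !sqr_sqrtr ?addr_ge0 ?sqr_ge0//.
by apply: sumr_ge0 => k _; rewrite sqr_ge0.
Qed.

(** * The detection theorem *)

Theorem theorem5 (R : realType) (n m d : nat)
  (n_ge2 : (2 <= n)%N) (n_lt_m : (n < m)%N) (d_ge1 : (1 <= d)%N)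
  (theta : 'I_m -> d.-tuple R) (sigma : 'I_m -> R)
  (sigma_gt0 : forall j : 'I_m, 0 < sigma j)
  (pistar : {ffun 'I_n -> 'I_m}) (pistar_inj : injective pistar)
  (dO : measure_display) (Omega : measurableType dO)
  (P : probability Omega R)
  (xi : 'I_n -> {RV P >-> d.-tuple R}) (xis : 'I_m -> {RV P >-> d.-tuple R})
  (xi_gauss : forall i : 'I_n, standard_gaussian (xi i))
  (xis_gauss : forall j : 'I_m, standard_gaussian (xis j))
  (noise_indep : mutually_independent (sum_family xi xis))
  (pihat : sample R n m d -> {ffun 'I_n -> 'I_m})
  (pihat_LSL : LSL_estimator pihat)
  (alpha : R) (alpha_gt0 : 0 < alpha) (alpha_lt1 : alpha < 1) :
  let L : R := ln (4 * n%:R * m%:R / alpha) in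
  let r : R := noise_ratio sigma in
  ((2 * (4 * d%:R * L) `^ (1 / 4) + 2 * Num.sqrt (2 * L))%:E
     <= kappa_in_in theta sigma pistar)%E ->
  ((Num.sqrt (2 * (r - 1) * d%:R)
      + 2 * (4 * r ^+ 2 * d%:R * L) `^ (1 / 4)
      + 2 * Num.sqrt (2 * r * L))%:E
     <= kappa_in_out theta sigma pistar)%E ->
  ((1 - alpha)%:E
     <= pushforward P (observe theta sigma pistar xi xis)
          [set x | pihat x = pistar])%E.
Proof.
move=> L r kin kout.
have n0 : 0 < n%:R :> R by rewrite ltr0n (ltn_trans _ n_ge2).
have m_gt0 : (0 < m)%N by apply: ltn_trans n_lt_m; exact: ltn_trans n_ge2.
have m0 : 0 < m%:R :> R by rewrite ltr0n.
have Narg0 : 0 < 4 * n%:R * m%:R / alpha by rewrite divr_gt0// !mulr_gt0.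
have L0 : 0 <= L.
  rewrite ln_ge0// ler_pdivlMr// mul1r (le_trans (ltW alpha_lt1))//.
  have : 1 <= n%:R * m%:R :> R.
    by rewrite -natrM ler1n muln_gt0 m_gt0 (ltn_trans _ n_ge2).
  by rewrite -mulrA; lra.
have expL : expR (- L) = alpha / (4 * n%:R * m%:R).
  by rewrite expRN lnK ?posrE// invf_div.
have r1 : 1 <= r.
  have := noise_ratio_ge sigma (Ordinal m_gt0) (Ordinal m_gt0).
  by rewrite divff// gt_eqF.
pose l := Num.sqrt (2 * L).
have l0 : 0 <= l by rewrite sqrtr_ge0.
have l2 : l ^+ 2 / 2 = L by rewrite sqr_sqrtr ?mulr_ge0// mulrAC mulfV ?mul1r.
pose h := Num.sqrt d%:R + l.
have h0 : 0 < h by rewrite ltr_pwDl// sqrtr_gt0 ltr0n.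
pose D := obs_sqr_dist theta sigma pistar xi xis.
pose q j := if j \in outliers pistar then r else 1.
have q1 j : 1 <= q j by rewrite /q; case: ifP.
have q_gt0 j : 0 < q j by rewrite (lt_le_trans _ (q1 j)).
pose v i j := (- sigma j) ^+ 2 + sigma (pistar i) ^+ 2.
have vE i j : v i j = sigma (pistar i) ^+ 2 + sigma j ^+ 2.
  by rewrite /v sqrrN addrC.
have v_gt0 i j : 0 < v i j by rewrite vE addr_gt0// exprn_gt0.
have sep_le i j : j != pistar i ->
    Num.sqrt (2 * (q j - 1) * d%:R) + 2 * (4 * q j ^+ 2 * d%:R * L) `^ (1 / 4)
      + 2 * Num.sqrt (2 * q j * L) <= sep theta sigma (pistar i) j.
  move=> ji; have pi_in : pistar i \notin outliers pistar.
    by rewrite !inE negbK imset_f ?inE.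
  rewrite /q; case: ifPn => jO; rewrite -lee_fin.
    apply: (le_trans kout).
    by apply: (@bigmin_le_cond _ _ _ _ (pistar i, j)); rewrite /= pi_in.
  rewrite subrr mulr0 mul0r sqrtr0 add0r expr1n !mulr1; apply: (le_trans kin).
  apply: (@bigmin_le_cond _ _ _ _ (pistar i, j)).
  by rewrite /= pi_in jO eq_sym.
(* The bad event of a pair: a true match that is too distant, or that coincides,
   or a false match that is too close. *)
pose B (p : 'I_n * 'I_m) : set Omega :=
  if p.2 == pistar p.1 then
    [set w | v p.1 p.2 * h ^+ 2 <= D p.1 p.2 w] `|` [set w | D p.1 p.2 w <= 0]
  else [set w | D p.1 p.2 w <= v p.1 p.2 * (Num.sqrt (q p.2) * h) ^+ 2].
have mD i j : measurable_fun setT (D i j).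
  exact: (measurable_sqr_norm_comb (xi i) (xis j)).
have indep i j A C : measurable A -> measurable C ->
    P (xi i @^-1` A `&` xis j @^-1` C) =
    (P (xi i @^-1` A) * P (xis j @^-1` C))%E.
  move=> mA mC.
  have ij : inl i != inr j :> 'I_n + 'I_m by [].
  exact: (mutually_independent_pair noise_indep ij mA mC).
have mle (f g : Omega -> R) : measurable_fun setT f -> measurable_fun setT g ->
    measurable [set w | f w <= g w].
  by move=> mf mg; rewrite -[X in measurable X]setTI; exact: measurable_fun_le.
have mB p : measurable (B p).
  rewrite /B; case: ifP => _; last exact: mle.
  by apply: measurableU; exact: mle.
(* As [2 exp (- L) = alpha / (2 n m)], the [n m] bad events have total
   probability at most [alpha / 2]. *)
have PB p : (P (B p) <= (2 * expR (- L))%:E)%E.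
  case: p => i j; rewrite /B/=; case: eqVneq => [ji|ji].
    apply: (le_trans (measureU2 _ _ _)); [exact: mle|exact: mle|].
    rewrite mulr_natl mulr2n EFinD leeD//.
      rewrite -l2; apply: (central_upper_tail d_ge1 (xi_gauss i)
        (xis_gauss j) (indep i j) (v_gt0 i j)) => //.
      by move=> k; rewrite ji subrr.
    exact: (sqr_norm_comb_small_ball d_ge1 (xi_gauss i)
      (xis_gauss j) (indep i j) _ (v_gt0 i j)).
  apply: (@le_trans _ _ (expR (- L))%:E); last first.
    by rewrite lee_fin ler_peMl ?expR_ge0// ler1n.
  rewrite -[in leRHS]l2; apply: (noncentral_lower_tail (xi_gauss i)
    (xis_gauss j) (indep i j) (v_gt0 i j)) => //.
  - by rewrite mulr_gt0// sqrtr_gt0.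
  have := separation_suffices (q1 j) L0 (sep_le i j ji).
  by rewrite sep_sqr -vE.
have [mU PU] := finite_union_bound mB PB.
rewrite card_prod !card_ord natrM in PU.
have {}PU : (P (\bigcup_p B p) <= alpha%:E)%E.
  apply: (le_trans PU); rewrite lee_fin expL -subr_ge0.
  rewrite (_ : _ - _ = alpha / 2) ?divr_ge0 ?ltW//.
  by field; rewrite ?gt_eqF.
have [mpi pi_inj pi_min] := pihat_LSL.
have mS : measurable (observe theta sigma pistar xi xis @^-1`
    [set x | pihat x = pistar]).
  rewrite -[X in measurable X]setTI; apply: measurable_observe => //.
apply: (@le_trans _ _ (P (~` \bigcup_p B p))).
  by rewrite probability_setC// EFinB leeB.
apply: le_measure; rewrite ?inE//; first exact: measurableC.
move=> w Uw /=.
have good p : ~ B p w by move=> Bw; apply: Uw; exists p.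
set x := observe _ _ _ _ _ w.
apply: contrapT => neq.
have Dmatch i : 0 < D i (pistar i) w < 2 * sigma (pistar i) ^+ 2 * h ^+ 2.
  have := good (i, pistar i); rewrite /B/= eqxx vE => /not_orP[/negP + /negP].
  by rewrite -!ltNge => h1 ->; rewrite (lt_le_trans h1)// mulr_natl mulr2n.
have Dother i j : j != pistar i ->
    (sigma (pistar i) ^+ 2 + sigma j ^+ 2) * (q j * h ^+ 2) < D i j w.
  move=> ji; have := good (i, j); rewrite /B/= (negbTE ji) vE => /negP.
  by rewrite -ltNge exprMn sqr_sqrtr// ltW.
have D0 i j : 0 < D i j w.
  have [->|/Dother] := eqVneq j (pistar i); first by case/andP: (Dmatch i).
  apply: lt_trans; apply: mulr_gt0; last by rewrite mulr_gt0 ?exprn_gt0.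
  by rewrite addr_gt0 ?exprn_gt0.
have := pi_min x pistar pistar_inj.
rewrite !LSL_objective_observe// lee_fin leNgt => /negP; apply.
apply: (LSL_strict_min sigma_gt0 (pi_inj x) pistar_inj neq _ r1 Dmatch Dother).
by rewrite exprn_gt0.
Qed.
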